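(* The pair $(V_{\mathbb{BZL}}(\mathbf{D}_2\oplus\mathbb{OL}\oplus\mathbf{D}_2),\,V_{\mathbb{BZL}}(\mathbf{D}_5))$, where $V_{\mathbb{BZL}}(\mathbf{D}_5)=V_{\mathbb{BZL}}(\mathbf{D}_2\oplus\mathbb{KA}\oplus\mathbf{D}_2)$, is a splitting pair in the lattice of subvarieties of $\mathbb{SAOL}$.
   Context: A pair $(x,y)$ of elements of a lattice $L$ is a splitting pair in $L$ iff $y\nleq x$ and every element of $L$ is $\le x$ or $\ge y$. A BI-lattice is an algebra $(L,\wedge,\vee,\cdot',0,1)$ such that $(L,\wedge,\vee,0,1)$ is a bounded lattice and $\cdot'$ is order-reversing with $a''=a$. A pseudo-Kleene algebra is a BI-lattice with $a\wedge a'\le b\vee b'$ for all $a,b$; a Kleene algebra is a distributive pseudo-Kleene algebra; an ortholattice is a BI-lattice with $x\vee x'=1$ for all $x$. $\mathbb{KA}$ and $\mathbb{OL}$ are the varieties of Kleene algebras and ortholattices. A BZ-lattice is an algebra $(L,\wedge,\vee,\cdot',\cdot^{\sim},0,1)$ such that $(L,\wedge,\vee,\cdot',0,1)$ is a pseudo-Kleene algebra and $\cdot^{\sim}$ is order-reversing with $a\wedge a^{\sim}=0$ and $a\le a^{\sim\sim}=a^{\sim\prime}$ for all $a$; $\mathbb{BZL}$ is the variety of BZ-lattices. A PBZ$^*$-lattice is a BZ-lattice satisfying $(x\wedge x')^{\sim}\approx x^{\sim}\vee x'^{\sim}$ that is paraorthomodular (if $a\le b$ and $a'\wedge b=0$,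 then $a=b$); PBZ$^*$-lattices form a variety. An antiortholattice is a PBZ$^*$-lattice in which $\{x:x\vee x'=1\}=\{0,1\}$, equivalently a PBZ$^*$-lattice whose Brouwer complement is trivial, i.e. $0^{\sim}=1$ and $a^{\sim}=0$ for all $a\ne 0$; $\mathbb{AOL}$ is the class of antiortholattices. $V_{\mathbb{BZL}}(\mathbb{C})$ denotes the variety of BZ-lattices generated by $\mathbb{C}$. $\mathbb{SDM}$ is the variety of PBZ$^*$-lattices satisfying $(x\wedge y)^{\sim}\approx x^{\sim}\vee y^{\sim}$, and $\mathbb{SAOL}=\mathbb{SDM}\cap V_{\mathbb{BZL}}(\mathbb{AOL})$. $\mathbf{D}_5$ is the five-element chain with its unique involution and the trivial Brouwer complement. For a pseudo-Kleene algebra $\mathbf{K}$, $\mathbf{D}_2\oplus\mathbf{K}\oplus\mathbf{D}_2$ is obtained from $\mathbf{K}$ by adding a new bottom element $0$ and a new top element $1$, extending the involution of $\mathbf{K}$ by $0'=1$, $1'=0$, and endowing the result with the trivial Brouwer complement; it is an antiortholattice. For a class $\mathbb{C}$ of pseudo-Kleene algebras, $\mathbf{D}_2\oplus\mathbb{C}\oplus\mathbf{D}_2=\{\mathbf{D}_2\oplus\mathbf{K}\oplus\mathbf{D}_2:\mathbf{K}\in\mathbb{C}\}$. *)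

(* Defs.v *)
From Stdlib Require Import FunctionalExtensionality.
From mathcomp Require Import all_boot all_order.

Set Implicit Arguments.
Unset Strict Implicit.
Unset Printing Implicit Defensive.

(* Lattices are algebras over arbitrary types (no decidability, no choice
   structure), so that they are closed under quotients and arbitrary products;
   the order is recovered from the meet. *)
Definition meet_le (T : Type) (meet : T -> T -> T) (x y : T) : Prop :=
  meet x y = x.

Record BILattice := MkBILattice {
  bi_car :> Type;
  meet : bi_car -> bi_car -> bi_car;
  join : bi_car -> bi_car -> bi_car;
  inv : bi_car -> bi_car;
  bot : bi_car;
  top : bi_car;
  meetC : commutative meet;
  meetA : associative meet;
  joinC : commutative join;
  joinA : associative join;
  joinK : forall x y, meet x (join x y) = x;
  meetK : forall x y, join x (meet x y) = x;
  le_bot : forall x, meet_le meet bot x;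
  le_top : forall x, meet_le meet x top;
  invK : involutive inv;
  inv_anti : forall x y, meet_le meet x y -> meet_le meet (inv y) (inv x)
}.

Arguments meet {_} _ _.
Arguments join {_} _ _.
Arguments inv {_} _.
Arguments bot {_}.
Arguments top {_}.

Declare Scope bz_scope.
Delimit Scope bz_scope with bz.
Local Open Scope bz_scope.

Notation "x ∧ y" := (meet x y) (at level 40, left associativity) : bz_scope.
Notation "x ∨ y" := (join x y) (at level 50, left associativity) : bz_scope.
Notation "x ^⊥" := (inv x) (at level 2, left associativity, format "x ^⊥")
  : bz_scope.
Notation "x ⊑ y" := (meet_le meet x y) (at level 70, no associativity)
  : bz_scope.

Definition pseudo_kleene (L : BILattice) : Prop :=
  forall a b : L, a ∧ a^⊥ ⊑ b ∨ b^⊥.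

Definition kleene (L : BILattice) : Prop :=
  pseudo_kleene L /\
  forall x y z : L, x ∧ (y ∨ z) = (x ∧ y) ∨ (x ∧ z).

Definition ortholattice (L : BILattice) : Prop :=
  forall x : L, x ∨ x^⊥ = top.

Record PKAlgebra := MkPKAlgebra {
  pk_bi :> BILattice;
  pkP : pseudo_kleene pk_bi
}.

Record BZLattice := MkBZLattice {
  bz_pk :> PKAlgebra;
  brw : bz_pk -> bz_pk;
  brw_anti : forall x y, x ⊑ y -> brw y ⊑ brw x;
  meet_brw : forall x, x ∧ brw x = bot;
  le_brw_brw : forall x, x ⊑ brw (brw x);
  brw_brwE : forall x, brw (brw x) = (brw x)^⊥
}.

Arguments brw {_} _.

Notation "x ^∼" := (brw x) (at level 2, left associativity, format "x ^∼")
  : bz_scope.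

Definition paraorthomodular (L : BILattice) : Prop :=
  forall a b : L, a ⊑ b -> a^⊥ ∧ b = bot -> a = b.

Definition bzclass := BZLattice -> Prop.

Definition PBZs : bzclass := fun A =>
  (forall x : A, (x ∧ x^⊥)^∼ = x^∼ ∨ (x^⊥)^∼) /\ paraorthomodular A.

Definition AOL : bzclass := fun A =>
  PBZs A /\ forall x : A, x ∨ x^⊥ = top <-> x = bot \/ x = top.

Definition SDM : bzclass := fun A =>
  PBZs A /\ forall x y : A, (x ∧ y)^∼ = x^∼ ∨ y^∼.

Definition bz_hom (A B : BZLattice) (f : A -> B) : Prop :=
  [/\ forall x y, f (x ∧ y) = f x ∧ f y,
      forall x y, f (x ∨ y) = f x ∨ f y,
      forall x, f (x^⊥) = (f x)^⊥,
      forall x, f (x^∼) = (f x)^∼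
    & f bot = bot /\ f top = top].

Section Product.
Variables (I : Type) (A : I -> BZLattice).

Let T := forall i, A i.
Let pmeet (x y : T) : T := fun i => x i ∧ y i.
Let pjoin (x y : T) : T := fun i => x i ∨ y i.
Let pinv (x : T) : T := fun i => (x i)^⊥.
Let pbrw (x : T) : T := fun i => (x i)^∼.
Let pbot : T := fun _ => bot.
Let ptop : T := fun _ => top.

Let pext (x y : T) : (forall i, x i = y i) -> x = y.
Proof. exact: functional_extensionality_dep. Qed.

Let pleP (x y : T) : meet_le pmeet x y <-> forall i, x i ⊑ y i.
Proof.
split=> [xy i|xy]; last by apply: pext => i; apply: xy.
exact: (f_equal (fun z : T => z i) xy).
Qed.

Definition prod_BI : BILattice.
Proof.
apply: (@MkBILattice T pmeet pjoin pinv pbot ptop).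
- by move=> x y; apply: pext => i; apply: meetC.
- by move=> x y z; apply: pext => i; apply: meetA.
- by move=> x y; apply: pext => i; apply: joinC.
- by move=> x y z; apply: pext => i; apply: joinA.
- by move=> x y; apply: pext => i; apply: joinK.
- by move=> x y; apply: pext => i; apply: meetK.
- by move=> x; apply: pext => i; apply: le_bot.
- by move=> x; apply: pext => i; apply: le_top.
- by move=> x; apply: pext => i; apply: invK.
- by move=> x y /pleP xy; apply/pleP => i; apply: inv_anti.
Defined.

Lemma prod_pk : pseudo_kleene prod_BI.
Proof. by move=> x y; apply/pleP => i; apply: pkP. Qed.

Definition bz_prod : BZLattice.
Proof.
apply: (@MkBZLattice (MkPKAlgebra prod_pk) pbrw).
- by move=> x y /pleP xy; apply/pleP => i; apply: brw_anti.
- by move=> x; apply: pext => i; apply: meet_brw.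
- by move=> x; apply/pleP => i; apply: le_brw_brw.
- by move=> x; apply: pext => i; apply: brw_brwE.
Defined.

End Product.

Record variety (W : bzclass) : Prop := MkVariety {
  variety_H : forall (A B : BZLattice) (f : A -> B),
    bz_hom f -> (forall y, exists x, f x = y) -> W A -> W B;
  variety_S : forall (A B : BZLattice) (f : B -> A),
    bz_hom f -> injective f -> W A -> W B;
  variety_P : forall (I : Type) (A : I -> BZLattice),
    (forall i, W (A i)) -> W (bz_prod A)
}.

Definition subclass (C D : bzclass) : Prop := forall A, C A -> D A.

Definition V_BZL (C : bzclass) : bzclass := fun A =>
  forall W, variety W -> subclass C W -> W A.

Definition SAOL : bzclass := fun A => SDM A /\ V_BZL AOL A.

Definition subvariety_of (S : bzclass) (W : bzclass) : Prop :=
  variety W /\ subclass W S.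

(* [L] is the carrier of the lattice, given as a subset of an ambient type
   on which [le] restricts to the lattice order. *)
Definition splitting_pair (T : Type) (L : T -> Prop) (le : T -> T -> Prop)
    (x y : T) : Prop :=
  [/\ L x, L y, ~ le y x & forall z, L z -> le z x \/ le y z].

Inductive ext (T : Type) : Type := Ebot | Emid of T | Etop.
Arguments Ebot {T}.
Arguments Etop {T}.

Section Sum.
Variable K : PKAlgebra.

Definition ext_meet (x y : ext K) : ext K :=
  match x, y with
  | Ebot, _ | _, Ebot => Ebot
  | Etop, z | z, Etop => z
  | Emid a, Emid b => Emid (a ∧ b)
  end.

Definition ext_join (x y : ext K) : ext K :=
  match x, y with
  | Etop, _ | _, Etop => Etop
  | Ebot, z | z, Ebot => z
  | Emid a, Emid b => Emid (a ∨ b)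
  end.

Definition ext_inv (x : ext K) : ext K :=
  match x with Ebot => Etop | Emid a => Emid (a^⊥) | Etop => Ebot end.

Definition ext_brw (x : ext K) : ext K :=
  if x is Ebot then Etop else Ebot.

Lemma meet_idem (L : BILattice) (x : L) : x ∧ x = x.
Proof. by rewrite -{2}(meetK x x) joinK. Qed.

Lemma join_idem (L : BILattice) (x : L) : x ∨ x = x.
Proof. by rewrite -{2}(joinK x x) meetK. Qed.

Definition D2_BI_D2 : BILattice.
Proof.
apply: (@MkBILattice (ext K) ext_meet ext_join ext_inv Ebot Etop).
- by case=> [|a|] [|b|] //=; rewrite meetC.
- by case=> [|a|] [|b|] [|c|] //=; rewrite meetA.
- by case=> [|a|] [|b|] //=; rewrite joinC.
- by case=> [|a|] [|b|] [|c|] //=; rewrite joinA.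
- by case=> [|a|] [|b|] //=; rewrite ?joinK ?meet_idem.
- by case=> [|a|] [|b|] //=; rewrite ?meetK ?join_idem.
- by case.
- by case.
- by case=> //= a; rewrite invK.
- case=> [|a|] [|b|] //=; rewrite /meet_le //=.
  by case=> ab; congr Emid; apply: inv_anti.
Defined.

Lemma D2_BI_D2_pk : pseudo_kleene D2_BI_D2.
Proof. by case=> [|a|] [|b|] //=; rewrite /meet_le /= pkP. Qed.

Definition D2_sum_D2 : BZLattice.
Proof.
apply: (@MkBZLattice (MkPKAlgebra D2_BI_D2_pk) ext_brw).
- by case=> [|a|] [|b|].
- by case.
- by case.
- by case.
Defined.

End Sum.

Definition D2_class_D2 (C : PKAlgebra -> Prop) : bzclass := fun A =>
  exists K : PKAlgebra, C K /\ A = D2_sum_D2 K.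

(* Every ortholattice underlies a [PKAlgebra], so [D2_class_D2 ortholattice]
   really ranges over all ortholattices. *)
Lemma ortholattice_pseudo_kleene (L : BILattice) :
  ortholattice L -> pseudo_kleene L.
Proof. by move=> olL a b; rewrite olL; apply: le_top. Qed.

Section Chain5.
Import Order.TTheory.

Let cmin (x y : 'I_5) : 'I_5 := Order.min x y.
Let cmax (x y : 'I_5) : 'I_5 := Order.max x y.
Let cbrw (x : 'I_5) : 'I_5 := if x == ord0 then ord_max else ord0.

Let cleP (x y : 'I_5) : meet_le cmin x y <-> (x <= y)%N.
Proof. by split=> [/min_idPl|xy]; [|apply/min_idPl]. Qed.

Definition D5_BI : BILattice.
Proof.
apply: (@MkBILattice 'I_5 cmin cmax (@rev_ord 5) ord0 ord_max).
- exact: minC.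
- exact: minA.
- exact: maxC.
- exact: maxA.
- by move=> x y; apply/min_idPl; rewrite le_max lexx.
- by move=> x y; apply/max_idPl; rewrite ge_min lexx.
- by move=> x; apply/cleP.
- by move=> x; apply/cleP; rewrite -ltnS.
- exact: rev_ordK.
- by move=> x y /cleP xy; apply/cleP; rewrite /= leq_sub2l.
Defined.

Lemma D5_pk : pseudo_kleene D5_BI.
Proof.
move=> a b; apply/cleP.
by case: a => [[|[|[|[|[|?]]]]] ?] //; case: b => [[|[|[|[|[|?]]]]] ?].
Qed.

Definition D5 : BZLattice.
Proof.
apply: (@MkBZLattice (MkPKAlgebra D5_pk) cbrw).
- move=> x y /cleP xy; apply/cleP; rewrite /cbrw.
  case: (eqVneq x ord0) => [_|x0]; first by rewrite -ltnS.
  case: (eqVneq y ord0) => // y0; case/eqP: x0; apply: val_inj.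
  by apply/eqP; move: xy; rewrite y0 leqn0.
- move=> x; rewrite /cbrw; case: eqVneq => [->|_]; first exact/cleP.
  by rewrite /meet /= /cmin minC; apply/cleP.
- move=> x; apply/cleP; rewrite /cbrw; case: (eqVneq x ord0) => [->|] //=.
  by rewrite -ltnS /= ltn_ord.
- move=> x; rewrite /cbrw; case: (eqVneq x ord0) => _; exact: val_inj.
Defined.
End Chain5.

(* Main.v *)
From mathcomp Require Import all_boot boolp classical_sets.
Require Import Defs.

(** The heart of the matter is that a subvariety [Z] of SAOL either contains
    [D5] or consists of algebras built from the sums [D2_sum_D2 K] with [K] an
    ortholattice.

    In a member [A] of SAOL the elements [z^∼] form a Boolean lattice and behave
    like central elements, because in an antiortholattice, where they are only
    0 and 1, the required identities are immediate ([meet_brw_joinl] and its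
    companions). For an ultrafilter [U] of this Boolean lattice, identifying [x]
    and [y] when [x ∧ e = y ∧ e] for some [e] in [U] is therefore a congruence;
    every [z^∼] becomes 0 or 1 in the quotient, so the quotient has the trivial
    Brouwer complement. Given distinct elements of [A], the prime filter theorem
    provides a [U] that keeps them apart. Hence the quotients of [A] of this
    special kind, which lie in [Z], separate the points of [A]
    ([SAOL_separated]).

    Let [B] be such a quotient. The identity of SDM makes 0 meet-irreducible in
    [B]. Call an element proper if it is neither 0 nor 1. If [x ∧ x^⊥] takes
    the same value [w] on all proper [x], then the proper elements form the
    interval from [w] to [w^⊥], which is an ortholattice [K], and [B] is
    [D2_sum_D2 K]; without proper elements [B] has two elements and embeds in
    the sum over the trivial ortholattice. If it takes two values [p] and [q], then pseudo-Kleeneness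
    gives the chain
    [bot, p ∧ q, p ∨ q, (p ∨ q)^⊥, (p ∧ q)^⊥, top], a subalgebra of [B] that
    maps onto [D5]; so [D5] is in [Z] ([ortholattice_or_D5]).

    The two alternatives exclude each other, because the identity [idOL],
    by which the nonzero values of [y ∧ y^⊥] all coincide, holds in the sums
    over ortholattices and fails in [D5].

    Finally [D5] is [D2_sum_D2 K3] for the three-element chain [K3]. A prime
    filter of a Kleene algebra [K] yields a map from [K] to [K3], these maps
    separate points ([kleene_separated]), and each extends to a homomorphism
    from [D2_sum_D2 K] to [D2_sum_D2 K3]. So the sums over Kleene algebras lie
    in the variety of [D5]. *)

Set Implicit Arguments.
Unset Strict Implicit.
Unset Printing Implicit Defensive.

Local Open Scope bz_scope.

(** * Order and involution *)

Section Order.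
Variable L : BILattice.
Implicit Types x y z : L.

Lemma ble_refl x : x ⊑ x.
Proof. exact: meet_idem. Qed.

Lemma ble_trans y x z : x ⊑ y -> y ⊑ z -> x ⊑ z.
Proof. by rewrite /meet_le => <- yz; rewrite -meetA yz. Qed.

Lemma ble_antisym x y : x ⊑ y -> y ⊑ x -> x = y.
Proof. by rewrite /meet_le meetC => -> . Qed.

Lemma ble_joinP x y : x ⊑ y <-> x ∨ y = y.
Proof.
split=> [<-|<-]; last exact: joinK.
by rewrite joinC meetC meetK.
Qed.

Lemma ble_meetl x y : x ∧ y ⊑ x.
Proof. by rewrite /meet_le (meetC x y) -meetA meet_idem. Qed.

Lemma ble_meetr x y : x ∧ y ⊑ y.
Proof. by rewrite meetC; apply: ble_meetl. Qed.

Lemma ble_meet z x y : z ⊑ x -> z ⊑ y -> z ⊑ x ∧ y.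
Proof. by rewrite /meet_le meetA => -> ->. Qed.

Lemma ble_joinl x y : x ⊑ x ∨ y.
Proof. exact: joinK. Qed.

Lemma ble_joinr x y : y ⊑ x ∨ y.
Proof. by rewrite joinC; apply: ble_joinl. Qed.

Lemma ble_join z x y : x ⊑ z -> y ⊑ z -> x ∨ y ⊑ z.
Proof. by rewrite !ble_joinP -joinA => xz ->. Qed.

Lemma meet_mono x y z t : x ⊑ y -> z ⊑ t -> x ∧ z ⊑ y ∧ t.
Proof.
move=> xy zt; apply: ble_meet.
  exact: ble_trans (ble_meetl _ _) xy.
exact: ble_trans (ble_meetr _ _) zt.
Qed.

Lemma ble_bot x : x ⊑ bot -> x = bot.
Proof. by move=> xb; apply: ble_antisym xb (le_bot x). Qed.

Lemma meet_top x : x ∧ top = x.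
Proof. exact: le_top. Qed.

Lemma top_meet x : top ∧ x = x.
Proof. by rewrite meetC meet_top. Qed.

Lemma meet_bot x : x ∧ bot = bot.
Proof. by rewrite meetC; apply: le_bot. Qed.

Lemma bot_meet x : bot ∧ x = bot.
Proof. exact: le_bot. Qed.

Lemma join_bot x : x ∨ bot = x.
Proof. by rewrite joinC; apply/ble_joinP/le_bot. Qed.

Lemma bot_join x : bot ∨ x = x.
Proof. by rewrite joinC join_bot. Qed.

Lemma join_top x : x ∨ top = top.
Proof. exact/ble_joinP/le_top. Qed.

Lemma top_join x : top ∨ x = top.
Proof. by rewrite joinC join_top. Qed.

Lemma inv_swap x y : x ⊑ y^⊥ -> y ⊑ x^⊥.
Proof. by move/inv_anti; rewrite invK. Qed.

Lemma inv_bot : bot^⊥ = top :> L.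
Proof.
apply: ble_antisym (le_top _) _; apply: inv_swap; exact: le_bot.
Qed.

Lemma inv_top : top^⊥ = bot :> L.
Proof. by rewrite -inv_bot invK. Qed.

Lemma inv_join x y : (x ∨ y)^⊥ = x^⊥ ∧ y^⊥.
Proof.
apply: ble_antisym.
  by apply: ble_meet; apply: inv_anti; [apply: ble_joinl|apply: ble_joinr].
apply: inv_swap; apply: ble_join; apply: inv_swap.
  exact: ble_meetl.
exact: ble_meetr.
Qed.

Lemma inv_meet x y : (x ∧ y)^⊥ = x^⊥ ∨ y^⊥.
Proof. by rewrite -[RHS]invK inv_join !invK. Qed.

End Order.

Section BrouwerComplement.
Variable A : BZLattice.
Implicit Types x y : A.

Lemma brw_bot : bot^∼ = top :> A.
Proof.
apply: ble_antisym (le_top _) _.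
exact: ble_trans (le_brw_brw top) (brw_anti (le_bot _)).
Qed.

Lemma brw_top : top^∼ = bot :> A.
Proof. by rewrite -(top_meet top^∼) meet_brw. Qed.

Lemma brw3 x : x^∼^∼^∼ = x^∼.
Proof. by rewrite brw_brwE brw_brwE invK. Qed.

Lemma brw_join x y : (x ∨ y)^∼ = x^∼ ∧ y^∼.
Proof.
apply: ble_antisym.
  by apply: ble_meet; apply: brw_anti; [apply: ble_joinl|apply: ble_joinr].
have le_xy z : z ⊑ x^∼ ∧ y^∼ -> x ∨ y ⊑ z^∼.
  move=> zxy; apply: ble_join.
    apply: ble_trans (le_brw_brw x) _; apply: brw_anti.
    exact: ble_trans zxy (ble_meetl _ _).
  apply: ble_trans (le_brw_brw y) _; apply: brw_anti.
  exact: ble_trans zxy (ble_meetr _ _).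
apply: ble_trans (le_brw_brw _) _; apply: brw_anti; apply: le_xy.
exact: ble_refl.
Qed.

Lemma join_brw_inv x : x^∼ ∨ x^∼^⊥ = top.
Proof.
by rewrite -[LHS]invK inv_join invK meetC -brw_brwE meet_brw inv_bot.
Qed.

End BrouwerComplement.

(** * Homomorphisms, quotients and varieties *)

(** The involutive lattice reducts are compared by maps that need not preserve
    the bounds: those of a summand [K] are no longer distinguished in
    [D2_sum_D2 K]. *)
Record ilat_hom (K L : BILattice) (f : K -> L) : Prop := MkIlatHom {
  ilat_meet : forall x y, f (x ∧ y) = f x ∧ f y;
  ilat_join : forall x y, f (x ∨ y) = f x ∨ f y;
  ilat_inv : forall x, f (x^⊥) = (f x)^⊥
}.

Record congruence (A : BZLattice) (r : A -> A -> Prop) : Prop :=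
  MkCongruence {
  cong_refl : forall x, r x x;
  cong_sym : forall x y, r x y -> r y x;
  cong_trans : forall x y z, r x y -> r y z -> r x z;
  cong_meet : forall x y z t, r x y -> r z t -> r (x ∧ z) (y ∧ t);
  cong_join : forall x y z t, r x y -> r z t -> r (x ∨ z) (y ∨ t);
  cong_inv : forall x y, r x y -> r (x^⊥) (y^⊥);
  cong_brw : forall x y, r x y -> r (x^∼) (y^∼)
}.

Lemma ker_congruence (A B : BZLattice) (f : A -> B) :
  bz_hom f -> congruence (fun x y => f x = f y).
Proof.
case=> fm fj fi fb _; split=> //; first by move=> x y z -> .
- by move=> x y z t; rewrite !fm => -> ->.
- by move=> x y z t; rewrite !fj => -> ->.
- by move=> x y; rewrite !fi => ->.
- by move=> x y; rewrite !fb => ->.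
Qed.

(** Carriers have no decidable equality and no choice operator of their own, so
    the quotient is realised on a system of representatives picked by
    indefinite description. *)
Section Quotient.
Variables (A : BZLattice) (r : A -> A -> Prop).
Hypothesis rC : congruence r.

Definition repr (x : A) : A := sval (cid (ex_intro (r x) x (cong_refl rC x))).

Lemma repr_rel x : r x (repr x).
Proof. exact: svalP (cid _). Qed.

Lemma repr_eq x y : r x y -> repr x = repr y.
Proof.
move=> xy; rewrite /repr.
have rxy : r x = r y.
  apply/predeqP => z; split; apply: (cong_trans rC) => //.
  exact: (cong_sym rC).
move: (ex_intro _ _ _); rewrite rxy => ex.
by rewrite (Prop_irrelevance ex (ex_intro (r y) y (cong_refl rC y))).
Qed.

Lemma repr_idem x : repr (repr x) = repr x.
Proof. exact/esym/repr_eq/repr_rel. Qed.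

Let Q := {x : A | repr x = x}.
Let pi (x : A) : Q := exist _ (repr x) (repr_idem x).

Let pi_eqP x y : pi x = pi y <-> r x y.
Proof.
split=> [[xy]|xy]; last exact/eq_exist/repr_eq.
apply: (cong_trans rC) (repr_rel x) _; rewrite xy.
exact: (cong_sym rC) (repr_rel y).
Qed.

Let pi_sval q : pi (sval q) = q.
Proof. by case: q => x xr; apply: eq_exist. Qed.

Let sval_pi x : r (sval (pi x)) x.
Proof. exact: (cong_sym rC) (repr_rel x). Qed.

Let quotW (P : Q -> Prop) : (forall x, P (pi x)) -> forall q, P q.
Proof. by move=> Ppi q; rewrite -(pi_sval q). Qed.

Let qmeet (p q : Q) := pi (sval p ∧ sval q).
Let qjoin (p q : Q) := pi (sval p ∨ sval q).
Let qinv (p : Q) := pi (sval p)^⊥.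
Let qbrw (p : Q) := pi (sval p)^∼.

Let pi_meet x y : pi (x ∧ y) = qmeet (pi x) (pi y).
Proof. exact/esym/pi_eqP/(cong_meet rC). Qed.

Let pi_join x y : pi (x ∨ y) = qjoin (pi x) (pi y).
Proof. exact/esym/pi_eqP/(cong_join rC). Qed.

Let pi_inv x : pi (x^⊥) = qinv (pi x).
Proof. exact/esym/pi_eqP/(cong_inv rC). Qed.

Let pi_brw x : pi (x^∼) = qbrw (pi x).
Proof. exact/esym/pi_eqP/(cong_brw rC). Qed.

(* An inequality between classes holds between suitable representatives. *)
Let pi_le x y : meet_le qmeet (pi x) (pi y) -> pi x = pi (x ∧ y).
Proof. by rewrite pi_meet. Qed.

Let le_pi x y : x ⊑ y -> meet_le qmeet (pi x) (pi y).
Proof. by rewrite /meet_le -pi_meet => ->. Qed.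

Definition quotient_BI : BILattice.
Proof.
apply: (@MkBILattice Q qmeet qjoin qinv (pi bot) (pi top)).
- by elim/quotW=> x; elim/quotW=> y; rewrite -!pi_meet meetC.
- by elim/quotW=> x; elim/quotW=> y; elim/quotW=> z; rewrite -!pi_meet meetA.
- by elim/quotW=> x; elim/quotW=> y; rewrite -!pi_join joinC.
- by elim/quotW=> x; elim/quotW=> y; elim/quotW=> z; rewrite -!pi_join joinA.
- by elim/quotW=> x; elim/quotW=> y; rewrite -pi_join -pi_meet joinK.
- by elim/quotW=> x; elim/quotW=> y; rewrite -pi_meet -pi_join meetK.
- by elim/quotW=> x; apply/le_pi/le_bot.
- by elim/quotW=> x; apply/le_pi/le_top.
- by elim/quotW=> x; rewrite -!pi_inv invK.
- elim/quotW=> x; elim/quotW=> y /pi_le ->; rewrite -!pi_inv.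
  exact/le_pi/inv_anti/ble_meetr.
Defined.

Lemma quotient_pk : pseudo_kleene quotient_BI.
Proof.
elim/quotW=> x; elim/quotW=> y.
have := le_pi (pkP x y).
by rewrite pi_meet pi_join !pi_inv.
Qed.

Definition quotient : BZLattice.
Proof.
apply: (@MkBZLattice (MkPKAlgebra quotient_pk) qbrw).
- elim/quotW=> x; elim/quotW=> y /pi_le ->; rewrite -!pi_brw.
  exact/le_pi/brw_anti/ble_meetr.
- elim/quotW=> x; rewrite -!pi_brw; apply: etrans (esym (pi_meet _ _)) _.
  by rewrite meet_brw.
- by elim/quotW=> x; rewrite -!pi_brw; apply/le_pi/le_brw_brw.
- by elim/quotW=> x; rewrite -!pi_brw; apply: etrans (pi_inv _); rewrite brw_brwE.
Defined.

(** All that is used of the quotient; the construction itself stays hidden, as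
    its operations unfold to terms depending on proofs. *)
Lemma quotientP : exists (B : BZLattice) (p : A -> B),
  [/\ bz_hom p, forall q, exists x, p x = q & forall x y, p x = p y <-> r x y].
Proof.
exists quotient, (pi : A -> quotient); split=> [|q|]; last exact: pi_eqP.
- by split.
- by exists (sval q); apply: pi_sval.
Qed.

End Quotient.

Section Variety.
Variable W : bzclass.
Hypothesis varW : variety W.

(** Closure under subdirect products: the maps chosen for all pairs of distinct
    elements embed [A] in the product of their targets. *)
Lemma variety_separated (A : BZLattice) :
  (forall x y : A, x <> y ->
     exists (B : BZLattice) (f : A -> B), [/\ bz_hom f, W B & f x <> f y]) ->
  W A.
Proof.
move=> sep.
pose I := {xy : A * A | xy.1 <> xy.2}.
have [B fP] := choice (fun i : I => sep _ _ (svalP i)).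
have [f {}fP] : {f : forall i, A -> B i | forall i,
    [/\ bz_hom (f i), W (B i) & f i (sval i).1 <> f i (sval i).2]}.
  by exists (fun i => sval (cid (fP i))) => i; apply: svalP (cid (fP i)).
apply: (variety_S varW (f := fun x => (fun i => f i x) : bz_prod B)).
- by split=> [x y|x y|x|x|]; [..|split];
     apply: functional_extensionality_dep => i; case: (fP i) => -[fm fj fi fb [f0 f1]] _ _.
- move=> x y xy; have [//|nxy] := EM (x = y).
  have [_ _] := fP (exist _ (x, y) nxy); case.
  exact: (congr1 (fun g => g (exist _ (x, y) nxy)) xy).
- by apply: (variety_P varW) => i; have [] := fP i.
Qed.

(** If [f : X -> A] and [g : X -> B] with [g] onto and [ker f] inside [ker g],
    then [B] is a quotient of the subalgebra [f(X)] of [A], because [f(X)] is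
    isomorphic to [X / ker f]. *)
Lemma variety_span (A B X : BZLattice) (f : X -> A) (g : X -> B) :
  bz_hom f -> bz_hom g -> (forall b, exists x, g x = b) ->
  (forall x y, f x = f y -> g x = g y) -> W A -> W B.
Proof.
move=> fh gh gsurj fg WA.
have [Q [p [[pm pj pi pb [p0 p1]] psurj pE]]] := quotientP (ker_congruence fh).
have [s sK] := choice psurj.
have fs x : f (s (p x)) = f x by apply/pE.
have gs x : g (s (p x)) = g x by apply/fg.
have hom_s (C : BZLattice) (h : X -> C) :
    bz_hom h -> (forall x, h (s (p x)) = h x) -> bz_hom (h \o s).
  case=> hm hj hi hb [h0 h1] hs; split=> [q q'|q q'|q|q|] /=.
  - by rewrite -{1}[q]sK -{1}[q']sK -pm hs hm.
  - by rewrite -{1}[q]sK -{1}[q']sK -pj hs hj.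
  - by rewrite -{1}[q]sK -pi hs hi.
  - by rewrite -{1}[q]sK -pb hs hb.
  - by rewrite -p0 -p1 !hs.
have WQ : W Q.
  apply: (variety_S varW (hom_s _ _ fh fs)) WA => q q' /= ff.
  by rewrite -[q]sK -[q']sK; apply/pE.
apply: (variety_H varW (hom_s _ _ gh gs)) WQ => b.
by have [x <-] := gsurj b; exists (p x) => /=.
Qed.

End Variety.

Lemma V_BZL_variety C : variety (V_BZL C).
Proof.
split=> [A B f fh fs CA W vW CW|A B f fh fi CA W vW CW|I A CA W vW CW].
- exact: (variety_H vW fh fs (CA W vW CW)).
- exact: (variety_S vW fh fi (CA W vW CW)).
- by apply: (variety_P vW) => i; apply: CA.
Qed.

Lemma V_BZL_sub C : subclass C (V_BZL C).
Proof. by move=> A CA W _; apply. Qed.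

Lemma V_BZL_min C W : variety W -> subclass C W -> subclass (V_BZL C) W.
Proof. by move=> vW CW A; apply. Qed.

(** * Identities *)

Inductive term : Type :=
| Var of nat
| TMeet of term & term
| TJoin of term & term
| TInv of term
| TBrw of term.

Fixpoint eval (A : BZLattice) (v : nat -> A) (t : term) : A :=
  match t with
  | Var n => v n
  | TMeet s t => eval v s ∧ eval v t
  | TJoin s t => eval v s ∨ eval v t
  | TInv s => (eval v s)^⊥
  | TBrw s => (eval v s)^∼
  end.

Definition satisfies (s t : term) : bzclass := fun A =>
  forall v : nat -> A, eval v s = eval v t.

Lemma eval_hom (A B : BZLattice) (f : A -> B) (v : nat -> A) t :
  bz_hom f -> f (eval v t) = eval (f \o v) t.
Proof.
case=> fm fj fi fb _.
by elim: t => //= [s <- t <-|s <- t <-|s <-|s <-].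
Qed.

Lemma satisfies_variety s t : variety (satisfies s t).
Proof.
split=> [A B f fh fs sA v|A B f fh fi sA v|I A sA v].
- have [g gK] := choice fs.
  have -> : v = f \o (g \o v) by apply: funext => n /=; rewrite gK.
  by rewrite -!(eval_hom _ _ fh) sA.
- by apply: fi; rewrite !(eval_hom _ _ fh) sA.
- apply: functional_extensionality_dep => i.
  have projh : bz_hom ((fun x => x i) : bz_prod A -> A i) by split.
  by have := sA i ((fun x => x i) \o v); rewrite -!(eval_hom _ _ projh).
Qed.

Lemma V_BZL_satisfies C s t :
  (forall A, C A -> satisfies s t A) -> forall A, V_BZL C A -> satisfies s t A.
Proof. by move=> Cst; apply: V_BZL_min => //; apply: satisfies_variety. Qed.

Definition env3 (T : Type) (x y z : T) (n : nat) : T :=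
  match n with 0 => x | 1 => y | _ => z end.

(** * Antiortholattices and their ordinal sums *)

Definition idSDM : term * term :=
  (TBrw (TMeet (Var 0) (Var 1)), TJoin (TBrw (Var 0)) (TBrw (Var 1))).

(** The orthomodular law for the elements [x^∼^∼]: it is an identity that holds
    whenever these elements are only 0 and 1, and it stands in for
    paraorthomodularity, which as a quasi-identity is not visibly preserved by
    quotients. *)
Definition idOM : term * term :=
  let dia t := TBrw (TBrw t) in
  let lhs := TMeet (TJoin (TBrw (Var 0)) (TMeet (dia (Var 0)) (dia (Var 1))))
    (dia (Var 0)) in
  (TMeet lhs (dia (Var 1)), lhs).

(** Paraorthomodularity follows since [a ⊑ b] and [a^⊥ ∧ b = bot] force
    [a ∧ a^⊥ = bot] and [b ∧ b^⊥ = bot]. The SDM identity and orthomodularity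
    turn an element with this property into one equal to its double Brouwer
    complement, so that orthomodularity applies again to [a] and [b]. *)
Lemma satisfies_SDM (A : BZLattice) :
  satisfies idSDM.1 idSDM.2 A -> satisfies idOM.1 idOM.2 A -> SDM A.
Proof.
move=> sdm om.
have sdmE (x y : A) : (x ∧ y)^∼ = x^∼ ∨ y^∼.
  exact: (sdm (env3 x y y)).
have omE (x y : A) :
    (x^∼ ∨ (x^∼^∼ ∧ y^∼^∼)) ∧ x^∼^∼ ⊑ y^∼^∼.
  exact: (om (env3 x y y)).
have closed_le (x y : A) : x^∼^∼ ∧ y^∼ = bot ->
      y^∼^∼ ⊑ x^∼^∼ -> x^∼^∼ = y^∼^∼.
  move=> xy yx; apply: (ble_antisym _ yx).
  have := omE x y; rewrite (meetC x^∼^∼) yx.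
  suff -> : x^∼ ∨ y^∼^∼ = top by rewrite top_meet.
  by rewrite -[LHS]invK inv_join -!brw_brwE brw3 xy inv_bot.
have sharp_closed (x : A) : x ∧ x^⊥ = bot -> x^∼^∼ = x.
  move=> xx.
  have brw_le (y : A) : y^∼ ⊑ y^⊥.
    by rewrite -[y^∼]invK -brw_brwE; apply/inv_anti/le_brw_brw.
  have le_x : x^⊥^∼ ⊑ x by have := brw_le x^⊥; rewrite invK.
  have dia_le : x^∼^∼ = x^⊥^∼.
    have := @closed_le x (x^⊥^∼); rewrite brw3; apply.
      by rewrite -brw_join -sdmE meetC -[x^⊥ ∧ x]meetC xx brw_bot brw_top.
    exact: ble_trans le_x (le_brw_brw x).
  apply: ble_antisym (le_brw_brw x); by rewrite dia_le.
split=> //; split=> // a b ab ba.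
have bb : b ∧ b^⊥ = bot.
  apply: ble_bot; rewrite -ba meetC; apply: meet_mono (ble_refl _).
  exact: inv_anti.
have aa : a ∧ a^⊥ = bot.
  by apply: ble_bot; rewrite -ba meetC; apply: meet_mono (ble_refl _) _.
rewrite -(sharp_closed a aa) -(sharp_closed b bb); apply: esym.
apply: closed_le; last by rewrite !sharp_closed.
rewrite sharp_closed // -[a^∼]invK -brw_brwE sharp_closed //.
by rewrite meetC.
Qed.

Lemma D2_sum_D2_SDM (K : PKAlgebra) : satisfies idSDM.1 idSDM.2 (D2_sum_D2 K).
Proof. by move=> v /=; case: (v 0) => [|a|]; case: (v 1) => [|b|]. Qed.

Lemma D2_sum_D2_OM (K : PKAlgebra) : satisfies idOM.1 idOM.2 (D2_sum_D2 K).
Proof. by move=> v /=; case: (v 0) => [|a|]; case: (v 1) => [|b|]. Qed.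

Lemma D2_sum_D2_AOL (K : PKAlgebra) : AOL (D2_sum_D2 K).
Proof.
have [pbz _] := satisfies_SDM (@D2_sum_D2_SDM K) (@D2_sum_D2_OM K).
split=> //; case=> [|a|]; split=> //=; try by [left|right].
by case.
Qed.

Lemma V_BZL_D2_sum_D2_SAOL C : subclass (V_BZL (D2_class_D2 C)) SAOL.
Proof.
move=> A CA; split.
  apply: satisfies_SDM; apply: (V_BZL_satisfies _ CA) => B [K [_ ->]].
    exact: D2_sum_D2_SDM.
  exact: D2_sum_D2_OM.
move=> W vW AW; apply: CA vW _ => B [K [_ ->]].
by apply: AW; apply: D2_sum_D2_AOL.
Qed.

Definition trivial_brw (A : BZLattice) : Prop :=
  forall x : A, x <> bot -> x^∼ = bot.

(** [x^∼] is always complemented by its involute, and an antiortholattice has no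
    complemented elements besides its bounds. *)
Lemma AOL_brw01 (A : BZLattice) (x : A) : AOL A -> x^∼ = bot \/ x^∼ = top.
Proof. by case=> _ sharp; apply/sharp; apply: join_brw_inv. Qed.

(** * Prime filters *)

(** The prime filter theorem for a distributive subset [S] of a lattice, which
    itself need not be distributive: it is used both in a Kleene algebra and on
    the elements [z^∼] of a BZ-lattice. *)
Section PrimeFilter.
Variable L : BILattice.
Variables (S I : L -> Prop) (a : L).
Hypothesis S_meet : forall x y, S x -> S y -> S (x ∧ y).
Hypothesis S_dist : forall x y z, S x -> S y -> S z ->
  x ∧ (y ∨ z) = (x ∧ y) ∨ (x ∧ z).
Hypothesis I_down : forall x y, S x -> x ⊑ y -> I y -> I x.
Hypothesis I_join : forall x y, I x -> I y -> I (x ∨ y).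
Hypotheses (Sa : S a) (Ia : ~ I a).

Record filter_off (F : L -> Prop) : Prop := FilterOff {
  filter_sub : forall x, F x -> S x;
  filter_up : forall x y, F x -> S y -> x ⊑ y -> F y;
  filter_meet : forall x y, F x -> F y -> F (x ∧ y);
  filter_disj : forall x, F x -> ~ I x
}.

Lemma prime_filter : exists P : L -> Prop,
  [/\ filter_off P, P a
    & forall x y, S x -> S y -> P (x ∨ y) -> P x \/ P y].
Proof.
(* The empty filter is admitted, since it is the union of the empty chain. *)
pose good F := filter_off F /\ forall x, F x -> F a.
have [F FG tot|M [[Mf Ma] Mmax]] := @Zorn_bigcup L good.
  split=> [|x [F0 FF0 F0x]]; last first.
    by exists F0 => //; have [_] := FG _ FF0; apply; exact: F0x.
  split=> [x [G FFG Gx]|x y [G FFG Gx] Sy xy|x y [G FFG Gx] [H FFH Hy]|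
           x [G FFG Gx]].
  - by have [Gf _] := FG _ FFG; apply: filter_sub Gf _ Gx.
  - by exists G => //; have [Gf _] := FG _ FFG; apply: filter_up Gf _ _ Gx _ _.
  - have [GH|HG] := tot _ _ FFG FFH.
      by exists H => //; have [Hf _] := FG _ FFH;
        apply: filter_meet Hf _ _ _ Hy; apply: GH.
    by exists G => //; have [Gf _] := FG _ FFG;
      apply: filter_meet Gf _ _ Gx _; apply: HG.
  - by have [Gf _] := FG _ FFG; apply: filter_disj Gf _ Gx.
have Maa : M a.
  have [//|nMa] := EM (M a); exfalso.
  apply: (Mmax (fun y => S y /\ a ⊑ y)).
    split=> [|sub]; first by move=> x /Ma.
    by apply/nMa/sub; split=> //; apply: ble_refl.
  split=> [|x _]; last by split=> //; apply: ble_refl.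
  split=> [x []//|x y [Sx ax] Sy xy|x y [Sx ax] [Sy ay]|x [Sx ax] Ix].
  - by split=> //; apply: ble_trans ax xy.
  - by split; [apply: S_meet|apply: ble_meet].
  - exact/Ia/(I_down Sa ax).
(* By maximality, the filter generated by [M] and an outside element [z] meets
   the ideal. *)
have step z : S z -> ~ M z -> exists2 m, M m & I (m ∧ z).
  move=> Sz nMz; have [//|nex] := EM (exists2 m, M m & I (m ∧ z)).
  exfalso; apply: (Mmax (fun y => S y /\ exists2 m, M m & m ∧ z ⊑ y)).
    split=> [x Mx|sub].
      split; first exact: filter_sub Mf _ Mx.
      by exists x => //; apply: ble_meetl.
    by apply/nMz/sub; split=> //; exists a => //; apply: ble_meetr.
  split=> [|x _]; last by split=> //; exists a => //; apply: ble_meetl.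
  split=> [x []//|x y [Sx [m Mm mx]] Sy xy|x y [Sx [m Mm mx]] [Sy [n Mn ny]]|
           x [Sx [m Mm mx]] Ix].
  - by split=> //; exists m => //; apply: ble_trans mx xy.
  - split; first exact: S_meet.
    exists (m ∧ n); first exact: filter_meet Mf _ _ Mm Mn.
    apply: ble_meet.
      exact: ble_trans (meet_mono (ble_meetl _ _) (ble_refl _)) mx.
    exact: ble_trans (meet_mono (ble_meetr _ _) (ble_refl _)) ny.
  - apply: nex; exists m => //; apply: I_down mx Ix.
    by apply: S_meet => //; apply: filter_sub Mf _ Mm.
exists M; split=> // x y Sx Sy Mxy.
have [|nMx] := EM (M x); first by left.
have [|nMy] := EM (M y); first by right.
have [m Mm Imx] := step x Sx nMx; have [n Mn Iny] := step y Sy nMy.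
have Mmn := filter_meet Mf Mm Mn; have Smn := filter_sub Mf Mmn.
case: (filter_disj Mf (filter_meet Mf Mmn Mxy)).
rewrite S_dist //; apply: I_join.
  apply: I_down Imx; first exact: S_meet.
  exact: meet_mono (ble_meetl _ _) (ble_refl _).
apply: I_down Iny; first exact: S_meet.
exact: meet_mono (ble_meetr _ _) (ble_refl _).
Qed.

End PrimeFilter.

(** * Subdirect decomposition of the members of SAOL *)

(** The elements [z^∼] act as direct factors. Each identity is trivial when
    [z^∼] is 0 or 1, hence holds in all antiortholattices and in the variety
    that they generate. *)
Section SharpIdentities.
Variable A : BZLattice.
Hypothesis aolA : V_BZL AOL A.
Implicit Types x y z : A.

Lemma meet_brw_joinl x y z : (x ∨ y) ∧ z^∼ = (x ∧ z^∼) ∨ (y ∧ z^∼).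
Proof.
pose s := TMeet (TJoin (Var 0) (Var 1)) (TBrw (Var 2)).
pose t := TJoin (TMeet (Var 0) (TBrw (Var 2))) (TMeet (Var 1) (TBrw (Var 2))).
apply: (V_BZL_satisfies (s := s) (t := t) _ aolA (env3 x y z)) => B aolB v /=.
by have [->|->] := AOL_brw01 (v 2) aolB; rewrite ?meet_top ?meet_bot ?join_bot.
Qed.

Lemma meet_brw_joinr x y z : x ∧ (y^∼ ∨ z^∼) = (x ∧ y^∼) ∨ (x ∧ z^∼).
Proof.
pose s := TMeet (Var 0) (TJoin (TBrw (Var 1)) (TBrw (Var 2))).
pose t := TJoin (TMeet (Var 0) (TBrw (Var 1))) (TMeet (Var 0) (TBrw (Var 2))).
apply: (V_BZL_satisfies (s := s) (t := t) _ aolA (env3 x y z)) => B aolB v /=.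
have [->|->] := AOL_brw01 (v 1) aolB; have [->|->] := AOL_brw01 (v 2) aolB;
by rewrite ?(join_bot, bot_join, top_join, meet_top, meet_bot, join_idem).
Qed.

Lemma meet_brw_inv x z : x^⊥ ∧ z^∼ = (x ∧ z^∼)^⊥ ∧ z^∼.
Proof.
pose s := TMeet (TInv (Var 0)) (TBrw (Var 1)).
pose t := TMeet (TInv (TMeet (Var 0) (TBrw (Var 1)))) (TBrw (Var 1)).
apply: (V_BZL_satisfies (s := s) (t := t) _ aolA (env3 x z z)) => B aolB v /=.
by have [->|->] := AOL_brw01 (v 1) aolB; rewrite ?meet_top ?meet_bot.
Qed.

Lemma meet_brw_brw x z : x^∼ ∧ z^∼ = (x ∧ z^∼)^∼ ∧ z^∼.
Proof.
pose s := TMeet (TBrw (Var 0)) (TBrw (Var 1)).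
pose t := TMeet (TBrw (TMeet (Var 0) (TBrw (Var 1)))) (TBrw (Var 1)).
apply: (V_BZL_satisfies (s := s) (t := t) _ aolA (env3 x z z)) => B aolB v /=.
by have [->|->] := AOL_brw01 (v 1) aolB; rewrite ?meet_top ?meet_bot.
Qed.

End SharpIdentities.

(** Agreeing on some direct factor taken from [U]. *)
Lemma filter_congruence (A : BZLattice) (U : A -> Prop) :
  V_BZL AOL A -> (exists z, U z) -> (forall e, U e -> exists z, e = z^∼) ->
  (forall e f, U e -> U f -> U (e ∧ f)) ->
  congruence (fun x y => exists2 e, U e & x ∧ e = y ∧ e).
Proof.
move=> aolA [e0 Ue0] Ubrw Umeet.
have shrink (x y e f : A) : x ∧ e = y ∧ e -> x ∧ (e ∧ f) = y ∧ (e ∧ f).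
  by rewrite !meetA => ->.
split.
- by move=> x; exists e0.
- by move=> x y [e Ue xy]; exists e.
- move=> x y z [e Ue xy] [f Uf yz]; exists (e ∧ f); first exact: Umeet.
  by rewrite (shrink _ _ _ f xy) (meetC e) (shrink _ _ _ e yz).
- move=> x y z t [e Ue xy] [f Uf zt]; exists (e ∧ f); first exact: Umeet.
  have cut (a b : A) : (a ∧ b) ∧ (e ∧ f) = (a ∧ e) ∧ (b ∧ f).
    by rewrite -!meetA; congr (_ ∧ _); rewrite meetA (meetC b) -meetA.
  by rewrite !cut xy zt.
- move=> x y z t [e Ue xy] [f Uf zt]; exists (e ∧ f); first exact: Umeet.
  move: (shrink _ _ _ f xy) (shrink _ _ _ e zt); rewrite (meetC f).
  have [w ->] : exists w, e ∧ f = w^∼ by apply/Ubrw/Umeet.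
  by rewrite !(meet_brw_joinl aolA) => -> ->.
- move=> x y [e Ue xy]; exists e => //; have [w we] := Ubrw e Ue.
  by rewrite we (meet_brw_inv aolA) -we xy we -(meet_brw_inv aolA).
- move=> x y [e Ue xy]; exists e => //; have [w we] := Ubrw e Ue.
  by rewrite we (meet_brw_brw aolA) -we xy we -(meet_brw_brw aolA).
Qed.

(** The elements [e] of the form [z^∼] with [a ∧ e = b ∧ e] form a proper ideal.
    A prime filter [U] off this ideal keeps [a] and [b] distinct, and contains
    [x^∼] or [x^∼^∼] for each [x]: in the first case [x] is identified with 0,
    in the second [x^∼] is. *)
Lemma SAOL_separated (A : BZLattice) (a b : A) : SAOL A -> a <> b ->
  exists (B : BZLattice) (f : A -> B),
    [/\ bz_hom f, forall q, exists x, f x = q, f a <> f b,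
        trivial_brw B & bot <> top :> B].
Proof.
move=> [[_ sdmA] aolA] ab.
pose S (e : A) := exists z, e = z^∼.
have [||||||U [Uf Utop Uprime]] :=
    @prime_filter A S (fun e => S e /\ a ∧ e = b ∧ e) top.
- by move=> _ _ [x ->] [y ->]; exists (x ∨ y); rewrite brw_join.
- by move=> x _ _ _ [y ->] [z ->]; apply: meet_brw_joinr.
- move=> x y Sx; rewrite /meet_le meetC => xy [_ aby]; split=> //.
  by rewrite -xy !meetA aby.
- move=> _ _ [[x ->] ax] [[y ->] ay]; split.
    by exists (x ∧ y); rewrite sdmA.
  by rewrite !(meet_brw_joinr aolA) ax ay.
- by exists bot; rewrite brw_bot.
- by case=> _; rewrite !meet_top.
have Ubrw e : U e -> S e by apply: filter_sub Uf _.
have rC : congruence (fun x y : A => exists2 e, U e & x ∧ e = y ∧ e).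
  by apply: filter_congruence => //; [exists top|apply: filter_meet Uf].
have [B [p [ph psurj pE]]] := quotientP rC.
have [pm pj pi pb [p0 p1]] := ph.
exists B, p; split=> //.
- by move=> /pE [e Ue abe]; case: (filter_disj Uf Ue); split=> //; apply: Ubrw.
- move=> q; have [x <-] := psurj q; rewrite -p0 => nx; rewrite -pb.
  have [|||Ux|Ux] := Uprime (x^∼) (x^∼^∼).
  + by exists x.
  + by exists x^∼.
  + by rewrite brw_brwE join_brw_inv.
  + by case: nx; apply/pE; exists x^∼ => //; rewrite meet_brw bot_meet.
  + by apply/pE; exists x^∼^∼ => //; rewrite meet_brw bot_meet.
- rewrite -p0 -p1 => /pE [e Ue]; rewrite bot_meet top_meet => e0.
  by case: (filter_disj Uf Ue); split; [apply: Ubrw|rewrite -e0 !meet_bot].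
Qed.

(** * Homomorphisms out of ordinal sums *)

Section ExtLift.
Variables (K : PKAlgebra) (L : BILattice) (u : L) (f : K -> L).

Definition ext_lift (x : ext K) : L :=
  match x with Ebot => u | Emid k => f k | Etop => u^⊥ end.

Lemma ext_lift_hom : ilat_hom f -> (forall k, u ⊑ f k) ->
  ilat_hom (ext_lift : D2_BI_D2 K -> L).
Proof.
move=> [fm fj fi] uf.
have fu k : f k ⊑ u^⊥ by apply: inv_swap; rewrite -fi.
have uu : u ⊑ u^⊥ by apply: ble_trans (uf bot) (fu bot).
have le_meetr (x y : L) : x ⊑ y -> x = y ∧ x by rewrite meetC.
split; first 2 last.
- by case=> [|k|] //=; rewrite invK.
- case=> [|j|] [|k|] //=; rewrite ?meet_idem //;
    first [exact/esym/uf|exact/esym/fu|exact/esym/uu|exact: le_meetr].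
- case=> [|j|] [|k|] //=; rewrite ?join_idem //;
    first [exact/esym/ble_joinP|by rewrite joinC; apply/esym/ble_joinP].
Qed.

End ExtLift.

Lemma ext_lift_bz_hom (K : PKAlgebra) (B : BZLattice) (f : K -> B) :
  trivial_brw B -> bot <> top :> B -> ilat_hom f -> (forall k, f k <> bot) ->
  bz_hom (ext_lift bot f : D2_sum_D2 K -> B).
Proof.
move=> tB nB fh f0.
have [em ej ei] : ilat_hom (ext_lift bot f : D2_BI_D2 K -> B).
  by apply: ext_lift_hom => // k; apply: le_bot.
split=> //; last by rewrite /= inv_bot.
case=> [|k|] /=; first by rewrite brw_bot inv_bot.
- by rewrite tB.
- by rewrite inv_bot brw_top.
Qed.

Lemma trivial_brw_D2_sum_D2 (K : PKAlgebra) : trivial_brw (D2_sum_D2 K).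
Proof. by case. Qed.

Definition ext_map (K K' : PKAlgebra) (h : K -> K') :
    D2_sum_D2 K -> D2_sum_D2 K' :=
  ext_lift (Ebot : D2_sum_D2 K') (fun k => Emid (h k)).

Lemma ext_map_hom (K K' : PKAlgebra) (h : K -> K') :
  ilat_hom h -> bz_hom (ext_map h).
Proof.
move=> [hm hj hi]; apply: ext_lift_bz_hom => //.
  exact: trivial_brw_D2_sum_D2.
by split=> [x y|x y|x]; rewrite /= ?hm ?hj ?hi.
Qed.

Definition BI_bool : BILattice.
Proof. by apply: (@MkBILattice bool andb orb negb false true); do !case. Defined.

Definition BI_unit : BILattice.
Proof.
by apply: (@MkBILattice unit (fun _ _ => tt) (fun _ _ => tt) id tt tt); do !case.
Defined.

Definition K2 : PKAlgebra :=
  @MkPKAlgebra BI_bool (ltac:(apply: ortholattice_pseudo_kleene; by case)).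
Definition K1 : PKAlgebra :=
  @MkPKAlgebra BI_unit (ltac:(apply: ortholattice_pseudo_kleene; by case)).
Definition K3 : PKAlgebra := D2_sum_D2 K1.

Lemma trivial_brw_D5 : trivial_brw D5.
Proof. by move=> x x0; rewrite /= (negbTE (introN eqP x0)). Qed.

Lemma nontrivial_D5 : bot <> top :> D5.
Proof. by move/(congr1 val). Qed.

Definition c1 : D5 := @Ordinal 5 1 isT.
Definition c2 : D5 := @Ordinal 5 2 isT.

(** Collapses the innermost summand to the middle point of the chain. *)
Definition toD5 (K : PKAlgebra) : D2_sum_D2 (D2_sum_D2 K) -> D5 :=
  ext_lift (bot : D5) (ext_lift c1 (fun _ => c2) : D2_sum_D2 K -> D5).

Lemma toD5_hom K : bz_hom (@toD5 K).
Proof.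
apply: ext_lift_bz_hom; [exact: trivial_brw_D5|exact: nontrivial_D5| |].
  apply: ext_lift_hom => [|_]; last exact: val_inj.
  by split=> *; apply: val_inj.
by case=> [|k|] /(congr1 val).
Qed.

Lemma toD5_surj K (y : D5) : exists x, @toD5 K x = y.
Proof.
case: y => [[|[|[|[|[|//]]]]]] lt_y.
- by exists Ebot; apply: val_inj.
- by exists (Emid (Ebot : D2_sum_D2 K)); apply: val_inj.
- by exists (Emid (Emid bot : D2_sum_D2 K)); apply: val_inj.
- by exists (Emid (Etop : D2_sum_D2 K)); apply: val_inj.
- by exists Etop; apply: val_inj.
Qed.

Lemma toD5_inj : injective (@toD5 K1).
Proof. by case=> [|[|[]|]|] [|[|[]|]|] // /(congr1 val). Qed.

(** * Kleene algebras are separated by the three-element chain *)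

(** The value in the three-element chain of an element [x], given whether [x] and
    [x^⊥] belong to a fixed prime filter. Both answers positive and both
    negative give the middle element; for a single filter these two situations
    cannot both occur. *)
Definition K3_code (p q : bool) : K3 :=
  match p, q with
  | true, false => Etop
  | false, true => Ebot
  | _, _ => Emid (tt : K1)
  end.

(** Take a prime filter [U] containing [a] but not [b]. If [x] and [x^⊥] are in
    [U], then so is [y ∨ y^⊥], which is above [x ∧ x^⊥], and thus [y] or [y^⊥]
    is in [U]. This excludes the only combinations of memberships for which
    [K3_code] would fail to preserve meets or joins, and shows that [a] and [b]
    are not both sent to the middle. *)
Lemma kleene_separated (K : PKAlgebra) (a b : K) : kleene K -> ~ a ⊑ b ->
  exists h : K -> K3, ilat_hom h /\ h a <> h b.
Proof.
move=> [_ dist] ab.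
have [||||||U [Uf Ua Uprime]] :=
    @prime_filter K (fun _ => True) (fun x => x ⊑ b) a => //.
- by move=> x y _; apply: ble_trans.
- by move=> x y; apply: ble_join.
have up x y : U x -> x ⊑ y -> U y by move=> Ux; apply: (filter_up Uf Ux).
have Umeet x y : `[< U (x ∧ y) >] = `[< U x >] && `[< U y >].
  apply/asboolP/andP => [Uxy|[/asboolP Ux /asboolP Uy]].
    by split; apply/asboolP; apply: up Uxy _; [apply: ble_meetl|apply: ble_meetr].
  exact: filter_meet Uf _ _ Ux Uy.
have Ujoin x y : `[< U (x ∨ y) >] = `[< U x >] || `[< U y >].
  apply/asboolP/orP => [/(Uprime _ _ I I) [] Uz|[] /asboolP Uz].
  - by left; apply/asboolP.
  - by right; apply/asboolP.
  - exact: up Uz (ble_joinl _ _).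
  - exact: up Uz (ble_joinr _ _).
have Uregular x y :
    `[< U x >] && `[< U x^⊥ >] -> `[< U y >] || `[< U y^⊥ >].
  by rewrite -Umeet -Ujoin => /asboolP Ux; apply/asboolP; apply: up Ux (pkP x y).
exists (fun x => K3_code `[< U x >] `[< U x^⊥ >]); split; last first.
  have nUb : ~ U b by move=> Ub; case: (filter_disj Uf Ub); apply: ble_refl.
  have := Uregular a b; rewrite (asboolT Ua) (asboolF nUb) /=.
  by case: `[< _ >]; case: `[< _ >] => // /(_ isT).
split=> [x y|x y|x].
- rewrite inv_meet Umeet Ujoin; move: (Uregular x y) (Uregular y x).
  do 4!case: `[< _ >]; move=> //= C1 C2;
    by [have := C1 isT|have := C2 isT].
- rewrite inv_join Umeet Ujoin; move: (Uregular x y) (Uregular y x).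
  do 4!case: `[< _ >]; move=> //= C1 C2;
    by [have := C1 isT|have := C2 isT].
- by rewrite invK; do 2!case: `[< _ >].
Qed.

Lemma V_D5_kleene : subclass (D2_class_D2 (fun K : PKAlgebra => kleene K))
  (V_BZL (fun B => B = D5)).
Proof.
move=> _ [K [kK ->]]; set V := V_BZL _.
have vV : variety V by apply: V_BZL_variety.
have VK3 : V (D2_sum_D2 K3).
  by apply: (variety_S vV (toD5_hom K1) toD5_inj); apply: V_BZL_sub.
(* The constant map separates the bounds of the sum from all other elements,
   even if [K] is trivial. *)
have const_hom : ilat_hom (fun _ : K => Emid (tt : K1) : K3) by split.
apply: (variety_separated vV) => x y xy; exists (D2_sum_D2 K3).
suff [h hh hxy] : exists2 h : K -> K3, ilat_hom h & ext_map h x <> ext_map h y.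
  by exists (ext_map h); split=> //; apply: ext_map_hom.
case: x y xy => [|a|] [|b|] //= ab; try by exists (fun _ => Emid (tt : K1)).
have [h [hh hab]] : exists h : K -> K3, ilat_hom h /\ h a <> h b.
  have [le_ab|] := EM (a ⊑ b); last exact: kleene_separated.
  have [|h [hh hba]] := @kleene_separated K b a kK.
    by move=> le_ba; apply: ab; rewrite (ble_antisym le_ab le_ba).
  by exists h; split=> // /esym.
by exists h => // -[].
Qed.

(** * Antiortholattices with irreducible zero *)

Section Interval.
Variables (L : BILattice) (w : L).
Hypothesis ww : w ⊑ w^⊥.

Let T := {x : L | w ⊑ x /\ x ⊑ w^⊥}.

Let ieq (p q : T) : sval p = sval q -> p = q.
Proof. by case: p q => [x xP] [y yP] /= xy; apply: eq_exist. Qed.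

Let imeet (p q : T) : T.
Proof.
exists (sval p ∧ sval q); case: p q => [x [wx xw]] [y [wy yw]] /=.
by split; [apply: ble_meet|apply: ble_trans (ble_meetl _ _) xw].
Defined.

Let ijoin (p q : T) : T.
Proof.
exists (sval p ∨ sval q); case: p q => [x [wx xw]] [y [wy yw]] /=.
by split; [apply: ble_trans wx (ble_joinl _ _)|apply: ble_join].
Defined.

Let iinv (p : T) : T.
Proof.
exists (sval p)^⊥; case: p => [x [wx xw]] /=.
by split; [apply: inv_swap|apply: inv_anti].
Defined.

Definition interval_BI : BILattice.
Proof.
apply: (@MkBILattice T imeet ijoin iinv (exist _ w (conj (ble_refl w) ww))
  (exist _ w^⊥ (conj ww (ble_refl w^⊥)))).
- by move=> p q; apply/ieq/meetC.
- by move=> p q r; apply/ieq/meetA.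
- by move=> p q; apply/ieq/joinC.
- by move=> p q r; apply/ieq/joinA.
- by move=> p q; apply/ieq/joinK.
- by move=> p q; apply/ieq/meetK.
- by case=> [x [wx xw]]; apply/ieq.
- by case=> [x [wx xw]]; apply/ieq.
- by move=> p; apply/ieq/invK.
- by move=> p q /(congr1 sval) pq; apply/ieq/inv_anti.
Defined.

Lemma interval_ortholattice :
  (forall x, w ⊑ x -> x ⊑ w^⊥ -> x ∧ x^⊥ = w) -> ortholattice interval_BI.
Proof.
move=> comp [x [wx xw]]; apply: ieq => /=.
by rewrite -(comp x wx xw) inv_meet invK joinC.
Qed.

End Interval.

Definition mid (B : BZLattice) (x : B) : Prop := x <> bot /\ x <> top.

Section Irreducible.
Variable B : BZLattice.
Hypotheses (sdmB : SDM B) (tB : trivial_brw B) (nB : bot <> top :> B).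
Implicit Types x y u v : B.

Lemma meet_neq_bot x y : x <> bot -> y <> bot -> x ∧ y <> bot.
Proof.
move=> x0 y0 xy; apply: nB.
by have := (proj2 sdmB) x y; rewrite xy brw_bot !tB // join_bot.
Qed.

Lemma mid_inv x : mid x -> mid x^⊥.
Proof.
move=> [x0 x1]; split=> [x'0|x'1].
  by apply: x1; rewrite -[x]invK x'0 inv_bot.
by apply: x0; rewrite -[x]invK x'1 inv_top.
Qed.

Lemma mid_core_neq_bot x : mid x -> x ∧ x^⊥ <> bot.
Proof.
by move=> mx; case: (mx) (mid_inv mx) => ? _ [? _]; apply: meet_neq_bot.
Qed.

(** The six-element chain is [D2_sum_D2 (D2_sum_D2 K2)]. Its map to [B] through
    [u ⊑ v ⊑ v^⊥ ⊑ u^⊥] is one-to-one except when [v = v^⊥], and then it only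
    identifies the two elements that [toD5] identifies as well; so
    [variety_span] covers both cases. *)
Lemma D5_of_chain u v W : u <> bot -> u ⊑ v -> u <> v -> v ⊑ v^⊥ ->
  variety W -> W B -> W D5.
Proof.
move=> u0 uv nuv vv vW.
have v'u' : v^⊥ ⊑ u^⊥ by apply: inv_anti.
have [uv' vu' uu'] : [/\ u ⊑ v^⊥, v ⊑ u^⊥ & u ⊑ u^⊥].
  have uv' := ble_trans uv vv; have vu' := ble_trans vv v'u'.
  by split=> //; apply: ble_trans uv vu'.
have neq_bot x : u ⊑ x -> x <> bot.
  by move=> ux x0; apply/u0/ble_bot; rewrite -x0.
pose g (b : K2) : B := if b then v^⊥ else v.
have gh : ilat_hom g.
  split; last by case; rewrite /= ?invK.
    by case; case; rewrite /= ?meet_idem // 1?meetC.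
  by case; case; rewrite /= ?join_idem //; [rewrite joinC|]; apply/esym/ble_joinP.
have ug b : u ⊑ g b by case: b.
pose f : D2_sum_D2 K2 -> B := ext_lift u g.
have fh : ilat_hom f by apply: ext_lift_hom.
have f0 k : f k <> bot.
  by apply: neq_bot; case: k => [|k|] /=; [exact: ble_refl| |].
have eh := ext_lift_bz_hom tB nB fh f0.
apply: (variety_span vW eh (toD5_hom K2) (@toD5_surj K2)).
have f1 k : f k <> top.
  move=> fk; have := f0 (k^⊥).
  by rewrite (ilat_inv fh) fk inv_top.
have nuv' : u <> v^⊥ by move=> e; apply: nuv; apply: ble_antisym uv _; rewrite e.
have nvu' : v <> u^⊥ by move=> e; apply: nuv'; rewrite e invK.
have nv'u' : v^⊥ <> u^⊥ by move=> /(can_inj (@invK B))/esym.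
have nuu' : u <> u^⊥.
  by move=> e; apply: nuv; apply: ble_antisym uv _; rewrite e.
have fE j k : f j = f k ->
    ext_lift c1 (fun _ : K2 => c2) j = ext_lift c1 (fun _ : K2 => c2) k.
  by case: j k => [|[]|] [|[]|] //= e; congruence.
case=> [|x|] [|y|] //=; rewrite ?inv_bot => e.
- by case: (f0 y).
- by case: nB.
- by case: (f0 x).
- exact: fE.
- by case: (f1 x).
- by case: nB.
- by case: (f1 y).
Qed.

(** The alternative is decided by whether [x ∧ x^⊥] is constant on the elements
    other than the bounds. *)
Lemma ortholattice_or_D5 :
  V_BZL (D2_class_D2 (fun K : PKAlgebra => ortholattice K)) B \/
  forall W, variety W -> W B -> W D5.
Proof.
set V := V_BZL _; have vV : variety V by apply: V_BZL_variety.
have [[x [y [mx my xy]]]|same] :=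
    EM (exists x y, [/\ mid x, mid y & x ∧ x^⊥ <> y ∧ y^⊥]).
  right=> W; set p := x ∧ x^⊥; set q := y ∧ y^⊥.
  have core (z t : B) : z ∧ z^⊥ ⊑ (t ∧ t^⊥)^⊥.
    by rewrite inv_meet invK joinC; apply: pkP.
  apply: (@D5_of_chain (p ∧ q) (p ∨ q)).
  - by apply: meet_neq_bot; apply: mid_core_neq_bot.
  - exact: ble_trans (ble_meetl _ _) (ble_joinl _ _).
  - move=> e; apply: xy; apply: ble_antisym.
      by apply: ble_trans (ble_meetr p q); rewrite e; apply: ble_joinl.
    by apply: ble_trans (ble_meetl p q); rewrite e; apply: ble_joinr.
  - rewrite inv_join; apply: ble_join; apply: ble_meet; exact: core.
left; have [[x mx]|nomid] := EM (exists x, mid x); last first.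
  have all01 x : x = bot \/ x = top.
    have [|x0] := EM (x = bot); first by left.
    have [|x1] := EM (x = top); first by right.
    by case: nomid; exists x.
  (* A two-element algebra embeds in the three-element chain, the sum over the
     trivial ortholattice. *)
  pose f x : D2_sum_D2 K1 := if `[< x = bot >] then Ebot else Etop.
  have f0 : f bot = Ebot by rewrite /f asboolT.
  have f1 : f top = Etop by rewrite /f asboolF // => /esym.
  have fh : bz_hom f.
    split=> [x y|x y|x|x|//].
    + have [->|->] := all01 x; have [->|->] := all01 y;
      by rewrite ?(meet_bot, bot_meet, meet_top) ?f0 ?f1.
    + have [->|->] := all01 x; have [->|->] := all01 y;
      by rewrite ?(join_bot, bot_join, join_top) ?f0 ?f1.
    + by have [->|->] := all01 x; rewrite ?inv_bot ?inv_top ?f0 ?f1.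
    + by have [->|->] := all01 x; rewrite ?brw_bot ?brw_top ?f0 ?f1.
  apply: (variety_S vV fh).
    move=> x y; have [->|->] := all01 x; have [->|->] := all01 y;
    by rewrite ?f0 ?f1.
  by apply: V_BZL_sub; exists K1; split=> //; case.
(* The common value [w] lies below every element other than the bounds, and
   [w^⊥] above. *)
pose w := x ∧ x^⊥.
have coreE y : mid y -> y ∧ y^⊥ = w.
  by move=> my; have [//|ne] := EM (y ∧ y^⊥ = w); case: same; exists y, x.
have w0 : w <> bot by apply: mid_core_neq_bot.
have w'1 : w^⊥ <> top by move=> e; apply: w0; rewrite -[w]invK e inv_top.
have midE y : mid y <-> w ⊑ y /\ y ⊑ w^⊥.
  split=> [my|[wy yw]].
    split; first by rewrite -(coreE y my); apply: ble_meetl.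
    by apply: inv_swap; rewrite -(coreE y my); apply: ble_meetr.
  split=> e; first by apply/w0/ble_bot; rewrite -e.
  by apply: w'1; apply: ble_antisym (le_top _) _; rewrite -e.
have ww : w ⊑ w^⊥ by rewrite {2}/w inv_meet invK joinC; apply: pkP.
have ol : ortholattice (interval_BI ww).
  by apply: interval_ortholattice => y wy yw; apply/coreE/midE.
pose K := @MkPKAlgebra (interval_BI ww) (ortholattice_pseudo_kleene ol).
have fh : bz_hom (ext_lift bot (fun k : K => sval k) : D2_sum_D2 K -> B).
  apply: ext_lift_bz_hom => //; case=> y [wy yw] /= e.
  by apply/w0/ble_bot; rewrite -e.
apply: (variety_H vV fh); last by apply: V_BZL_sub; exists K.
move=> y; have [->|y0] := EM (y = bot); first by exists Ebot.
have [->|y1] := EM (y = top); first by exists Etop; rewrite /= inv_bot.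
have yP : w ⊑ y /\ y ⊑ w^⊥ by apply/midE.
by exists (Emid (exist _ y yP : K)).
Qed.

End Irreducible.

(** * The splitting pair *)

(** The inequality [x ∧ x^⊥ ∧ (y ∧ y^⊥)^∼^∼ ⊑ y ∧ y^⊥]. Under the trivial
    Brouwer complement the factor [(y ∧ y^⊥)^∼^∼] is 1 unless [y ∧ y^⊥] is 0,
    so the inequality says that nonzero values of [y ∧ y^⊥] are all equal. *)
Definition idOL : term * term :=
  let rhs := TMeet (Var 1) (TInv (Var 1)) in
  let lhs := TMeet (TMeet (Var 0) (TInv (Var 0))) (TBrw (TBrw rhs)) in
  (TMeet lhs rhs, lhs).

Lemma ortholattice_idOL (A : BZLattice) :
  D2_class_D2 (fun K : PKAlgebra => ortholattice K) A ->
  satisfies idOL.1 idOL.2 A.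
Proof.
move=> [K [olK ->]] v /=.
have core (a : K) : a ∧ a^⊥ = bot.
  by rewrite -[LHS]invK inv_meet invK joinC olK inv_top.
by case: (v 0) => [|a|] //; case: (v 1) => [|b|] //=; rewrite !core meet_idem.
Qed.

Lemma D5_not_idOL : ~ satisfies idOL.1 idOL.2 D5.
Proof. by move=> /(_ (env3 c2 c1 c1)) /= /(congr1 val). Qed.

Lemma D5_in_kleene : V_BZL (D2_class_D2 (fun K : PKAlgebra => kleene K)) D5.
Proof.
move=> W vW kW; apply: (variety_H vW (toD5_hom K1) (@toD5_surj K1)).
apply: kW; exists K3; split=> //; split; first exact: pkP.
by case=> [|[]|] [|[]|] [|[]|].
Qed.

Theorem corollary4p36 :
  (forall A : BZLattice,
     V_BZL (fun B => B = D5) A <->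
     V_BZL (D2_class_D2 (fun K : PKAlgebra => kleene K)) A) /\
  splitting_pair (subvariety_of SAOL) subclass
    (V_BZL (D2_class_D2 (fun K : PKAlgebra => ortholattice K)))
    (V_BZL (fun B => B = D5)).
Proof.
have V_D5E A : V_BZL (fun B => B = D5) A <->
    V_BZL (D2_class_D2 (fun K : PKAlgebra => kleene K)) A.
  split; apply: V_BZL_min; try exact: V_BZL_variety.
    by move=> B ->; apply: D5_in_kleene.
  exact: V_D5_kleene.
split=> //; split.
- by split; [apply: V_BZL_variety|apply: V_BZL_D2_sum_D2_SAOL].
- split; first exact: V_BZL_variety.
  by move=> A /V_D5E; apply: V_BZL_D2_sum_D2_SAOL.
- move=> sub; apply: D5_not_idOL.
  exact: V_BZL_satisfies ortholattice_idOL _ (sub _ (V_BZL_sub erefl)).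
move=> Z [vZ ZS]; have [ZD5|nZD5] := EM (Z D5).
  by right; apply: (V_BZL_min vZ) => B ->.
left=> A ZA; apply: variety_separated (V_BZL_variety _) _ _ => x y xy.
have [B [f [fh fs fxy tB nB]]] := SAOL_separated (ZS _ ZA) xy.
have ZB : Z B by exact: (variety_H vZ fh fs ZA).
exists B, f; split=> //.
have [sdmB _] := ZS _ ZB.
by have [//|/(_ Z vZ ZB)] := ortholattice_or_D5 sdmB tB nB.
Qed.
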